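(* Let $\Gamma$ be a connected ve-srg, let $G\le \mathrm{Aut}(\Gamma)$ be transitive on the vertices and on the edges of $\Gamma$, and let $1\neq N\triangleleft G$ be intransitive on $V(\Gamma)$. If the quotient graph $\Gamma_N$ is isomorphic to $K_2$, then $\Gamma$ is a complete bipartite graph.
   Context: A strongly regular graph with parameters $(n,k,\lambda,\mu)$ is a (finite, simple) regular graph with $n$ vertices and valency $k$, such that each pair of adjacent vertices lies in exactly $\lambda$ triangles and each pair of distinct non-adjacent vertices (if such exist) is joined by exactly $\mu$ paths of length 2. The complete graph $K_n$ is regarded as strongly regular with parameters $(n,n-1,n-2,0)$. A ve-srg is a strongly regular graph whose automorphism group is transitive on vertices and transitive on (undirected) edges. Quotient graph: if $G\le\mathrm{Aut}(\Gamma)$ is vertex-transitive and $1\neq N\triangleleft G$ is intransitive on $V(\Gamma)$, then $\Gamma_N$ is the graph whose vertices are the orbits ${}^Nx=\{h(x): h\in N\}$ of $N$ on $V(\Gamma)$, two distinct orbits ${}^Nx,{}^Ny$ being adjacent if and only if some $x'\in{}^Nx$ and some $y'\in{}^Ny$ are adjacent in $\Gamma$. *)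

(* Defs.v *)
(* A finite simple graph is a symmetric irreflexive relation
   [e : rel T] on a finite type [T] of vertices. *)
From mathcomp Require Import all_boot all_fingroup.

Set Implicit Arguments.
Unset Strict Implicit.
Unset Printing Implicit Defensive.

Definition neighbours (T : finType) (e : rel T) (x : T) : {set T} :=
  [set y | e x y].

(* The triangles on an edge xy, and the paths of length 2 joining x and y,
   correspond to the common neighbours of x and y.  The last clause is the
   convention that K_n has mu = 0. *)
Definition strongly_regular (T : finType) (e : rel T)
    (n k lambda mu : nat) : Prop :=
  [/\ #|T| = n,
      forall x, #|neighbours e x| = k,
      forall x y, e x y -> #|neighbours e x :&: neighbours e y| = lambda,
      forall x y, x != y -> ~~ e x y ->
        #|neighbours e x :&: neighbours e y| = mu
    & (forall x y, x != y -> e x y) -> mu = 0].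

Definition graph_aut (T : finType) (e : rel T) : {set {perm T}} :=
  [set s : {perm T} | [forall x, forall y, e (s x) (s y) == e x y]].

Definition edges (T : finType) (e : rel T) : {set {set T}} :=
  [set [set p.1; p.2] | p : T * T & e p.1 p.2].

Definition vertex_transitive (T : finType) (A : {set {perm T}}) : bool :=
  [transitive A, on [set: T] | 'P].

(* Not phrased with [transitive ...], which fails on the empty set: K_1 is
   edge-transitive. *)
Definition edge_transitive (T : finType) (e : rel T)
    (A : {set {perm T}}) : Prop :=
  {in edges e &, forall E F, F \in orbit ('P^*)%act A E}.

Definition ve_srg (T : finType) (e : rel T) : Prop :=
  (exists n k lambda mu, strongly_regular e n k lambda mu)
  /\ vertex_transitive (graph_aut e) /\ edge_transitive e (graph_aut e).

Definition connected_graph (T : finType) (e : rel T) : Prop :=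
  forall x y, connect e x y.

Definition quotient_vertex (T : finType) (N : {set {perm T}}) : finType :=
  {X : {set T} | X \in [set orbit 'P N x | x in [set: T]]}.

Definition quotient_edge (T : finType) (e : rel T) (N : {set {perm T}}) :
    rel (quotient_vertex N) :=
  fun X Y => (X != Y) && [exists x in val X, exists y in val Y, e x y].
Arguments quotient_edge {T} e N _ _.

Definition graph_iso (T U : finType) (e : rel T) (f : rel U) : Prop :=
  exists2 h : T -> U, bijective h & forall x y, f (h x) (h y) = e x y.

Definition complete_edge (n : nat) : rel 'I_n := fun i j => i != j.
Arguments complete_edge n _ _ : clear implicits.

Definition complete_bipartite (T : finType) (e : rel T) : Prop :=
  exists A B : {set T},
    [/\ A != set0, B != set0, [disjoint A & B], A :|: B = [set: T]
      & forall x y, e x y =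
          ((x \in A) && (y \in B)) || ((x \in B) && (y \in A))].

(* Main.v *)
Require Import Defs.
From mathcomp Require Import all_boot all_fingroup.

(** The group [G] permutes the orbits of its normal subgroup [N].  The quotient
    supplies one edge joining two different orbits, so edge-transitivity forces
    every edge to join two different orbits ([edges_cross_orbits]).  There are
    only two orbits, hence they form a bipartition of the graph.

    It remains to see that a connected bipartite strongly regular graph is
    complete bipartite ([bipartite_srg_cross_adjacent]).  Two vertices on
    opposite sides never have a common neighbour; if some such pair were
    non-adjacent, then mu = 0.  But in a graph with mu = 0 adjacency-or-equality
    is transitive, so a connected one is complete
    ([connected_no_common_neighbours_adjacent]), which contradicts the choice of
    the pair. *)

(** A path of length 2 has a shortcut unless its ends coincide, so any walk
    contracts to a vertex or to an edge. *)
Lemma connected_no_common_neighbours_adjacent (T : finType) (e : rel T) :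
  symmetric e -> connected_graph e ->
  (forall x y, x != y -> ~~ e x y ->
    #|neighbours e x :&: neighbours e y| = 0) ->
  forall x y, x != y -> e x y.
Proof.
move=> e_sym e_conn mu0 x y neq_xy.
have /connectP[p] := e_conn x y.
elim/last_ind: p y neq_xy => [|p z IHp] y neq_xy.
  by move=> _ /= y_x; rewrite y_x eqxx in neq_xy.
rewrite rcons_path last_rcons => /andP[x_p e_wz] y_z; rewrite y_z in neq_xy *.
move: e_wz; have [<- // | neq_xw e_wz] := eqVneq x (last x p).
have e_xw : e x (last x p) by apply: IHp.
apply: contraT => not_e_xz.
have /eqP := mu0 _ _ neq_xy not_e_xz.
rewrite cards_eq0 => /eqP/setP/(_ (last x p)).
by rewrite !inE e_xw e_sym e_wz.
Qed.

(** A common neighbour of two differently coloured vertices would need a third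
    colour, so a missing edge between the colour classes makes mu vanish. *)
Lemma bipartite_srg_cross_adjacent (T : finType) (e : rel T)
    (n k lambda mu : nat) (c : T -> bool) :
  symmetric e -> connected_graph e -> strongly_regular e n k lambda mu ->
  (forall x y, e x y -> c x != c y) ->
  forall x y, c x != c y -> e x y.
Proof.
move=> e_sym e_conn [_ _ _ e_mu _] c_proper x y neq_c.
have neq_xy : x != y by apply: contraNneq neq_c => ->.
apply: contraT => not_e_xy.
have mu0 : mu = 0.
  rewrite -(e_mu x y neq_xy not_e_xy); apply/eqP; rewrite cards_eq0.
  apply/eqP/setP => z; rewrite !inE.
  apply/negP => /andP[/c_proper cxz /c_proper cyz].
  by move: neq_c cxz cyz; case: (c x) (c y) (c z) => [] [] [].
have complete : e x y.
  apply: connected_no_common_neighbours_adjacent => // u v.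
  by rewrite -[RHS]mu0; apply: e_mu.
by rewrite complete in not_e_xy.
Qed.

(** If [s] in [N] carries [g y] to [g x], then the conjugate of [s] by the
    inverse of [g] carries [y] to [x], and it lies in [N] by normality. *)
Lemma normal_orbit_perm (T : finType) (G N : {group {perm T}}) (g : {perm T})
    (x y : T) :
  (N <| G)%g -> g \in G ->
  orbit 'P N (g x) = orbit 'P N (g y) -> orbit 'P N x = orbit 'P N y.
Proof.
move=> N_normal gG /orbit_eqP/orbitP[s sN /=]; rewrite /aperm => s_gy.
apply/orbit_eqP/orbitP.
have gVN : g^-1%g \in 'N(N)%g.
  by rewrite groupV; apply: subsetP (normal_norm N_normal) _ gG.
exists (s ^ g^-1)%g; first by rewrite memJ_norm.
by rewrite /= /aperm conjgE invgK !permM s_gy permK.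
Qed.

(** An edge inside an orbit would be the image of [ab] under some [g] in [G].
    Only the unordered pair is controlled, since [g] may swap the ends, so both
    [g a] and [g b] are just known to lie in that orbit, which is enough. *)
Lemma edges_cross_orbits (T : finType) (e : rel T) (G N : {group {perm T}})
    (a b : T) :
  (N <| G)%g -> edge_transitive e G ->
  e a b -> orbit 'P N a != orbit 'P N b ->
  forall x y, e x y -> orbit 'P N x != orbit 'P N y.
Proof.
move=> N_normal G_etrans e_ab neq_ab x y e_xy.
apply: contra neq_ab => /eqP eq_xy; apply/eqP.
have edgeE u v : e u v -> [set u; v] \in edges e.
  by move=> e_uv; apply/imsetP; exists (u, v); rewrite ?inE.
have /orbitP[g gG g_ab] := G_etrans _ _ (edgeE _ _ e_ab) (edgeE _ _ e_xy).
have orbit_xy w : w \in [set a; b] -> orbit 'P N (g w) = orbit 'P N x.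
  move=> w_ab; have : g w \in [set x; y].
    by rewrite -g_ab; apply/imsetP; exists w.
  by rewrite !inE => /orP[] /eqP->.
by apply: (normal_orbit_perm _ G N g) => //; rewrite !orbit_xy ?set21 ?set22.
Qed.

Lemma quotient_K2_orbits (T : finType) (e : rel T) (N : {group {perm T}}) :
  graph_iso (quotient_edge e N) (complete_edge 2) ->
  exists a b, [/\ e a b, orbit 'P N a != orbit 'P N b
    & forall x, orbit 'P N x = orbit 'P N a \/ orbit 'P N x = orbit 'P N b].
Proof.
case=> h [h' hK h'K] h_edge.
have : quotient_edge e N (h' ord0) (h' ord_max) by rewrite -h_edge !h'K.
case/andP=> neq01 /existsP[a /andP[a0 /existsP[b /andP[b1 e_ab]]]].
have orbit_of (X : quotient_vertex N) x : x \in val X -> val X = orbit 'P N x.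
  by have /imsetP[z _ ->] := valP X => /orbit_eqP.
exists a, b; split=> //.
  by rewrite -(orbit_of _ _ a0) -(orbit_of _ _ b1) (inj_eq val_inj).
move=> x.
have xP : orbit 'P N x \in [set orbit 'P N z | z in [set: T]].
  by apply: imset_f; rewrite inE.
rewrite -(orbit_of _ _ a0) -(orbit_of _ _ b1).
pose X : quotient_vertex N := exist _ (orbit 'P N x) xP.
rewrite -[orbit _ _ x]/(val X) -[X]hK; case: (h _) => [[|[|//]] lt_i].
  by left; congr (val (h' _)); apply: val_inj.
by right; congr (val (h' _)); apply: val_inj.
Qed.

Theorem lemma3p2 (T : finType) (e : rel T) (G N : {group {perm T}})
  (e_sym : symmetric e) (e_irr : irreflexive e)
  (e_conn : connected_graph e) (e_srg : ve_srg e)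
  (G_aut : G \subset graph_aut e)
  (G_vtrans : vertex_transitive G) (G_etrans : edge_transitive e G)
  (N_neq1 : N :!=: 1%g) (N_normal : (N <| G)%g)
  (N_intrans : ~~ vertex_transitive N)
  (quotient_K2 : graph_iso (quotient_edge e N) (complete_edge 2)) :
  complete_bipartite e.
Proof.
have [a [b [e_ab neq_ab two_orbits]]] := quotient_K2_orbits _ _ _ quotient_K2.
have [[n [k [lambda [mu e_par]]]] _] := e_srg.
have neq_ba : (orbit 'P N b == orbit 'P N a) = false.
  by rewrite eq_sym (negPf neq_ab).
pose c x := orbit 'P N x == orbit 'P N a.
have c_proper x y : e x y -> c x != c y.
  move/(edges_cross_orbits _ _ _ _ _ _ N_normal G_etrans e_ab neq_ab).
  rewrite /c; case: (two_orbits x) (two_orbits y) => -> [] ->;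
    by rewrite ?eqxx ?neq_ba.
have eE x y : e x y = (c x != c y).
  apply/idP/idP; first exact: c_proper.
  exact: (bipartite_srg_cross_adjacent _ _ n k lambda mu).
exists [set x | c x], [set x | ~~ c x]; split.
- by apply/set0Pn; exists a; rewrite inE /c.
- by apply/set0Pn; exists b; rewrite inE /c neq_ba.
- by rewrite -setI_eq0; apply/eqP/setP => x; rewrite !inE andbN.
- by apply/setP => x; rewrite !inE orbN.
- by move=> x y; rewrite eE !inE; case: (c x) (c y) => [] [].
Qed.
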